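(* Let $\mathcal{C}$ be a type I self-dual Weyl tensor and let $\Psi_0,\Psi_1,\Psi_2,\Psi_3,\Psi_4$ be its components in an arbitrary null frame (null bivector base $\{\mathbf{W},\mathbf{U},\mathbf{V}\}$). Put $$I = \Psi_0\Psi_4-4\Psi_1\Psi_3+3\Psi_2^2,\qquad J=\begin{vmatrix}\Psi_4&\Psi_3&\Psi_2\\ \Psi_3&\Psi_2&\Psi_1\\ \Psi_2&\Psi_1&\Psi_0\end{vmatrix},\qquad \beta=\sqrt[3]{J+\sqrt{J^2-I^3/27}},$$ where $\beta$ is a particular non-zero value of this root, and $$\alpha_1=\beta+\frac{I}{3\beta},\qquad \alpha_2=-\tfrac12\Big((1-\mathrm{i}\sqrt3)\beta+(1+\mathrm{i}\sqrt3)\frac{I}{3\beta}\Big),\qquad \alpha_3=-\tfrac12\Big((1+\mathrm{i}\sqrt3)\beta+(1-\mathrm{i}\sqrt3)\frac{I}{3\beta}\Big).$$ Then the principal transverse scalars $\Psi_a^{(i)}$, $i=1,2,3$ (the components of $\mathcal{C}$ in the principal transverse bivector base $\{\mathbf{W}_i,\mathbf{U}_i,\mathbf{V}_i\}$, where $\mathbf{W}_1,\mathbf{W}_2,\mathbf{W}_3$ are the principal 2-forms corresponding to $\alpha_1,\alpha_2,\alpha_3$) satisfy $\Psi_1^{(i)}=\Psi_3^{(i)}=0$ and $$\Psi_2^{(i)}=-\tfrac12\alpha_i,\qquad \Psi_0^{(i)}=\Psi_4^{(i)}=\frac{\alpha_j-\alpha_k}{2},$$ where $(i,j,k)$ runs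 over the cyclic permutations of $(1,2,3)$.
   Context: Everything is pointwise on an oriented, time-oriented 4-dimensional spacetime with metric $g$ of signature $(-+++)$ and volume element $\eta$. Self-dual 2-forms. $X$ is self-dual if $*X=\mathrm{i}X$, $*$ the Hodge dual. On the 3-dimensional complex space of self-dual 2-forms use the metric $(X,Y)=\frac12X_{\alpha\beta}Y^{\alpha\beta}$, i.e. the metric $\mathcal{G}=\frac12(G-\mathrm{i}\eta)$, $G$ being the usual metric on 2-forms. A unitary self-dual 2-form satisfies $(X,X)=-1$. The product of 2-forms is $(A\times B)_{\alpha\beta}=A_\alpha{}^{\lambda}B_{\lambda\beta}$, and $a\wedge b=a\otimes b-b\otimes a$. Weyl tensor. The self-dual Weyl tensor is $\mathcal{C}=\frac12(C-\mathrm{i}*C)$, $C$ the Weyl tensor, regarded as a trace-free, $(\cdot,\cdot)$-symmetric endomorphism of the space of self-dual 2-forms; $(A\otimes B)(X)=A\,(B,X)$. Its characteristic equation is $x^3-Ix-2J=0$ with $I=\frac12\operatorname{tr}\mathcal{C}^2$, $J=\frac16\operatorname{tr}\mathcal{C}^3$. Type I means that the three roots $\alpha_1,\alpha_2,\alpha_3$ are distinct, equivalently $27J^2\neq I^3$. Then there are unitary, mutually orthogonal eigenvectors $\mathbf{W}_i$, $\mathcal{C}(\mathbf{W}_i)=\alpha_i\mathbf{W}_i$, called principal 2-forms, unique up to sign, with $\mathcal{C}=-\sum_i\alpha_i\mathbf{W}_i\otimes\mathbf{W}_i$. They are taken with signs such that $\{\mathbf{W}_i\}$ is oriented: $\mathbf{W}_3=\mathrm{i}\sqrt2\,\mathbf{W}_1\times\mathbf{W}_2$.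 Null frames and components. A null tetrad $\{l,k,m,\bar m\}$ has $l,k$ real future-pointing null vectors, $m$ complex null, $l\cdot k=-1$, $m\cdot\bar m=1$, other products zero. Its associated null bivector base is $\mathbf{W}=\frac1{\sqrt2}(l\wedge k+m\wedge\bar m)$, $\mathbf{U}=-\frac1{\sqrt2}l\wedge\bar m$, $\mathbf{V}=\frac1{\sqrt2}k\wedge m$, the tetrad being oriented so that these are self-dual. The components $\Psi_a$ are defined by $$\tfrac12\mathcal{C}=\Psi_0\mathbf{U}\otimes\mathbf{U}+\Psi_1\mathbf{U}\tilde\otimes\mathbf{W}+\Psi_2(\mathbf{U}\tilde\otimes\mathbf{V}+\mathbf{W}\otimes\mathbf{W})+\Psi_3\mathbf{W}\tilde\otimes\mathbf{V}+\Psi_4\mathbf{V}\otimes\mathbf{V},$$ with $A\tilde\otimes B=A\otimes B+B\otimes A$. Principal transverse bivector bases. For $(i,j,k)$ a cyclic permutation of $(1,2,3)$, the principal transverse bivector base is $\{\mathbf{W}_i,\mathbf{U}_i,\mathbf{V}_i\}$ with $\mathbf{U}_i=\frac{\mathrm{i}}2(\mathbf{W}_j+\mathrm{i}\mathbf{W}_k)$, $\mathbf{V}_i=\frac{\mathrm{i}}2(\mathbf{W}_j-\mathrm{i}\mathbf{W}_k)$. (The roman $\mathrm{i}$ is the imaginary unit; the italic subscript $i$ is an index.) *)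

(* Defs.v *)
From HB Require Import structures.
From mathcomp Require Import all_boot all_order all_algebra.
From mathcomp Require Import complex.

Set Implicit Arguments.
Unset Strict Implicit.
Unset Printing Implicit Defensive.

Import Order.TTheory GRing.Theory Num.Theory.
Local Open Scope ring_scope.
Local Open Scope complex_scope.

(* Everything takes place in one tangent space, identified with R^4 by an
   arbitrary basis.  Vectors are row vectors with components v^a; 2-forms are
   antisymmetric matrices with covariant components X_ab, complex-valued
   unless stated otherwise. *)

Definition minkowski (R : rcfType) : 'M[R]_4 :=
  diag_mx (\row_(i < 4) if i == 0 then -1 else 1).

Definition dotR (R : rcfType) (g : 'M[R]_4) (u v : 'rV[R]_4) : R :=
  (u *m g *m v^T) 0 0.

(* The signature condition asks for an orthonormal frame, the rows of E.
   [reversed] is false when the basis identifying the tangent space with R^4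
   is positively oriented.  [arrow] is a timelike vector fixing the future
   cone. *)
Record spacetime_point (R : rcfType) := SpacetimePoint {
  metric : 'M[R]_4;
  reversed : bool;
  arrow : 'rV[R]_4;
  metric_signature : exists E : 'M[R]_4, E *m metric *m E^T = minkowski R;
  arrow_timelike : dotR metric arrow arrow < 0
}.

Definition tensor4 (K : Type) := 'I_4 -> 'I_4 -> 'I_4 -> 'I_4 -> K.

Definition levi_civita (K : comNzRingType) : tensor4 K := fun a b c d =>
  \det (\matrix_(i < 4, j < 4) (tnth [tuple a; b; c; d] i == j)%:R).

Section Forms.
Variables (R : rcfType) (S : spacetime_point R).
Local Notation C := R[i].

Definition volume : tensor4 R := fun a b c d =>
  (-1) ^+ reversed S * Num.sqrt (- \det (metric S)) * levi_civita R a b c d.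

Definition gC : 'M[C]_4 := map_mx (real_complex R) (metric S).

Definition dot (u v : 'rV[C]_4) : C := (u *m gC *m v^T) 0 0.

Definition toC (v : 'rV[R]_4) : 'rV[C]_4 := map_mx (real_complex R) v.

Definition conjv (v : 'rV[C]_4) : 'rV[C]_4 := map_mx conjc v.

(* X^ab *)
Definition raise (X : 'M[C]_4) : 'M[C]_4 := invmx gC *m X *m invmx gC.

(* u /\ v = u (x) v - v (x) u, after lowering the indices of u and v;
   no factor 1/2. *)
Definition wedge (u v : 'rV[C]_4) : 'M[C]_4 :=
  (u *m gC)^T *m (v *m gC) - (v *m gC)^T *m (u *m gC).

Definition form_dot (X Y : 'M[C]_4) : C :=
  2^-1 * \sum_(a < 4) \sum_(b < 4) X a b * raise Y a b.

(* (A x B)_ab = A_a^l B_lb *)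
Definition form_mul (A B : 'M[C]_4) : 'M[C]_4 := A *m invmx gC *m B.

(* Action of a double 2-form on 2-forms: (T X)_ab = 1/2 T_abcd X^cd.  The
   factor 1/2 makes A_ab B_cd act as A (x) B : X |-> A (B, X). *)
Definition contract (T : tensor4 C) (X : 'M[C]_4) : 'M[C]_4 :=
  \matrix_(a < 4, b < 4)
    (2^-1 * \sum_(c < 4) \sum_(d < 4) T a b c d * raise X c d).

Lemma contract_is_linear T : linear (contract T).
Proof.
move=> k X Y; apply/matrixP => a b; rewrite !mxE mulrCA -mulrDr; congr (_ * _).
rewrite mulr_sumr -big_split /=; apply: eq_bigr => c _.
rewrite mulr_sumr -big_split /=; apply: eq_bigr => d _.
rewrite /raise mulmxDr mulmxDl -scalemxAr -scalemxAl mxE [X in _ * (X + _)]mxE.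
by rewrite mulrDr mulrCA.
Qed.

HB.instance Definition _ T :=
  GRing.isLinear.Build C 'M[C]_4 'M[C]_4 _ (contract T) (contract_is_linear T).

Definition hodge : 'M[C]_4 -> 'M[C]_4 :=
  contract (fun a b c d => (volume a b c d)%:C).

HB.instance Definition _ := GRing.Linear.on hodge.

(* The antisymmetry of X is implied, since *X is always antisymmetric. *)
Definition self_dual : {vspace 'M[C]_4} := lker (linfun hodge - 'i *: \1)%VF.

Lemma self_dualP X : reflect (hodge X = 'i *: X) (X \in self_dual).
Proof.
rewrite memv_ker add_lfunE opp_lfunE scale_lfunE id_lfunE lfunE /= subr_eq0.
exact: eqP.
Qed.

(* C_abcd with all indices down. *)
Definition weyl_tensor (T : tensor4 R) : Prop :=
  [/\ forall a b c d, T b a c d = - T a b c d,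
      forall a b c d, T a b d c = - T a b c d,
      forall a b c d, T c d a b = T a b c d,
      forall a b c d, T a b c d + T a c d b + T a d b c = 0
    & forall b d,
        \sum_(a < 4) \sum_(c < 4) invmx (metric S) a c * T a b c d = 0].

(* 1/2 (C - i *C), with the dual taken on the first pair of indices. *)
Definition sd_weyl_tensor (T : tensor4 R) : tensor4 C := fun a b c d =>
  2^-1 * ((T a b c d)%:C
          - 'i * hodge (\matrix_(e < 4, f < 4) (T e f c d)%:C) a b).

Definition sd_weyl (T : tensor4 R) : 'M[C]_4 -> 'M[C]_4 :=
  contract (sd_weyl_tensor T).

HB.instance Definition _ T := GRing.Linear.on (sd_weyl T).

(* The endomorphism induced on the space of self-dual 2-forms.  The projection
   only serves to restrict the codomain: sd_weyl T takes its values in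
   self_dual. *)
Definition sd_weyl_end (T : tensor4 R) : 'End(subvs_of self_dual) :=
  linfun (vsproj self_dual \o sd_weyl T \o vsval).

Definition characteristic_poly (T : tensor4 R) : {poly C} :=
  char_poly (passmx.mxof (vbasis {: subvs_of self_dual})
                         (vbasis {: subvs_of self_dual}) (sd_weyl_end T)).

Definition type_I (T : tensor4 R) : Prop :=
  exists x y z : C,
    [/\ x != y, y != z, z != x
      & characteristic_poly T
        = ('X - x%:P) * ('X - y%:P) * ('X - z%:P)].

Record bivector_base := BivectorBase {
  baseW : 'M[C]_4; baseU : 'M[C]_4; baseV : 'M[C]_4
}.

Definition inv_sqrt2 : C := ((Num.sqrt 2)^-1)%:C.

Definition null_base (l k : 'rV[R]_4) (m : 'rV[C]_4) : bivector_base :=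
  {| baseW := inv_sqrt2 *: (wedge (toC l) (toC k) + wedge m (conjv m));
     baseU := - inv_sqrt2 *: wedge (toC l) (conjv m);
     baseV := inv_sqrt2 *: wedge (toC k) m |}.

Definition future_null (v : 'rV[R]_4) : Prop :=
  [/\ v != 0, dotR (metric S) v v = 0 & dotR (metric S) v (arrow S) < 0].

(* The last condition expresses that the tetrad is oriented. *)
Definition null_tetrad (l k : 'rV[R]_4) (m : 'rV[C]_4) : Prop :=
  [/\ [/\ future_null l, future_null k & dotR (metric S) l k = -1],
      [/\ dot m m = 0, dot (conjv m) (conjv m) = 0 & dot m (conjv m) = 1],
      [/\ dot (toC l) m = 0, dot (toC l) (conjv m) = 0,
          dot (toC k) m = 0 & dot (toC k) (conjv m) = 0]
    & [/\ baseW (null_base l k m) \in self_dual,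
          baseU (null_base l k m) \in self_dual
        & baseV (null_base l k m) \in self_dual]].

Definition tens (A B X : 'M[C]_4) : 'M[C]_4 := form_dot B X *: A.

Definition stens (A B X : 'M[C]_4) : 'M[C]_4 := tens A B X + tens B A X.

Definition weyl_components (T : tensor4 R) (B : bivector_base)
    (p0 p1 p2 p3 p4 : C) : Prop :=
  let: BivectorBase w u v := B in
  forall X, X \in self_dual ->
    2^-1 *: sd_weyl T X
    = p0 *: tens u u X + p1 *: stens u w X
      + p2 *: (stens u v X + tens w w X)
      + p3 *: stens w v X + p4 *: tens v v X.

(* The indices 1, 2, 3 are encoded as 0, 1, 2 : 'I_3. *)
Definition principal_forms (T : tensor4 R) (alpha : 'I_3 -> C)
    (P : 'I_3 -> 'M[C]_4) : Prop :=
  [/\ forall i, P i \in self_dual,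
      forall i, form_dot (P i) (P i) = -1,
      forall i j, i != j -> form_dot (P i) (P j) = 0,
      forall i, sd_weyl T (P i) = alpha i *: P i
    & P 2 = ('i * (Num.sqrt 2)%:C) *: form_mul (P 0) (P 1)].

(* ordS is the cyclic successor, so (i, ordS i, ordS (ordS i)) is a cyclic
   permutation of the three indices. *)
Definition transverse_base (P : 'I_3 -> 'M[C]_4) (i : 'I_3) : bivector_base :=
  let j := ordS i in let k := ordS j in
  {| baseW := P i;
     baseU := ('i / 2) *: (P j + 'i *: P k);
     baseV := ('i / 2) *: (P j - 'i *: P k) |}.

End Forms.

(* Main.v *)
Require Import Defs.
From HB Require Import structures.
From mathcomp Require Import all_boot all_order all_algebra.
From mathcomp Require Import complex reals ring.

Set Implicit Arguments.
Unset Strict Implicit.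
Unset Printing Implicit Defensive.

Import Order.TTheory GRing.Theory Num.Theory passmx.
Local Open Scope ring_scope.
Local Open Scope complex_scope.

(** In coordinates on a null bivector base the pairing is (ac' + ca')/2 - bb' and
    C has the traceless matrix of the Psi_a, whose characteristic polynomial is
    x^3 - I x - 2 J; Cardano's formula gives its roots alpha_i, which are distinct
    by type I.  Normalised eigenvectors W_1, W_2 are orthonormal, and
    i sqrt 2 W_1 x W_2 completes them as a vector product does; being orthogonal
    to both, it is a multiple of the third eigenvector.  Each transverse base is
    again a null bivector base, in which C is diagonal on W_i and mixes U_i, V_i
    only through alpha_j +/- alpha_k; the Psi_a^(i) are read off its matrix. *)

(** The literal matrix has the shape of [J], so both that determinant and the one of the
    characteristic equation become polynomials that [ring] can compare. *)
Lemma det_mx3 (K : comNzRingType) (a b c d e f g h i : K) :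
  \det (\matrix_(r < 3, s < 3)
    nth 0 (nth [::] [:: [:: a; b; c]; [:: d; e; f]; [:: g; h; i]] r) s)
  = a * (e * i - f * h) - b * (d * i - f * g) + c * (d * h - e * g).
Proof.
rewrite (expand_det_row _ ord0) !big_ord_recl big_ord0 /cofactor.
rewrite !(expand_det_row _ ord0) !big_ord_recl !big_ord0 /cofactor !det_mx11.
rewrite !mxE /= /bump /=; ring.
Qed.

(** * Symmetry, pairing and product of 2-forms *)

Section Forms.
Variables (R : rcfType) (S : spacetime_point R).
Local Notation C := R[i].

Lemma minkowski_unit : minkowski R \in unitmx.
Proof.
rewrite unitmxE det_diag unitfE prodf_seq_neq0; apply/allP => i _ /=.
by rewrite mxE; case: ifP; rewrite ?oppr_eq0 oner_neq0.
Qed.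

Lemma metric_unit : metric S \in unitmx.
Proof.
have [E EgE] := metric_signature S.
have := minkowski_unit; rewrite -EgE -mulmxA !unitmx_mul.
by case/and3P.
Qed.

(** Symmetry is not a field of the record: it comes from the signature condition, by cancelling the
    invertible frame [E] on both sides of E g^T E^T = E g E^T. *)
Lemma metric_sym : (metric S)^T = metric S.
Proof.
have [E EgE] := metric_signature S.
have := minkowski_unit; rewrite -{1}EgE -mulmxA !unitmx_mul => /and3P[uE _ uET].
have: (minkowski R)^T = minkowski R by rewrite tr_diag_mx.
rewrite -{1}EgE !trmx_mul trmxK -EgE !mulmxA.
by move/(can_inj (mulmxK uET))/(can_inj (mulKmx uE)).
Qed.

Lemma gC_unit : gC S \in unitmx.
Proof. by rewrite map_unitmx metric_unit. Qed.

Lemma gC_sym : (gC S)^T = gC S.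
Proof. by apply/matrixP => a b; rewrite !mxE -[in LHS]metric_sym mxE. Qed.

Lemma raise_linear : linear (raise S).
Proof.
by move=> a X Y; rewrite /raise mulmxDr mulmxDl -scalemxAr -scalemxAl.
Qed.

Lemma dotC u v : dot S u v = dot S v u.
Proof.
rewrite /dot -[in LHS](trmxK (u *m gC S *m v^T)) mxE.
by rewrite !trmx_mul trmxK gC_sym mulmxA.
Qed.

Lemma form_dotE X Y : form_dot S X Y = 2^-1 * \tr (X^T *m raise S Y).
Proof.
rewrite /form_dot /mxtrace exchange_big /=; congr (_ * _); apply: eq_bigr => b _.
by rewrite mxE; apply: eq_bigr => a _; rewrite [X^T _ _]mxE.
Qed.

Lemma form_dotC X Y : form_dot S X Y = form_dot S Y X.
Proof.
rewrite !form_dotE -[in LHS]mxtrace_tr /raise; set gi := invmx _.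
rewrite !trmx_mul trmxK.
have -> : gi^T = gi by rewrite trmx_inv gC_sym.
by rewrite -[X in _ * \tr X = _]mulmxA [in LHS]mxtrace_mulC !mulmxA.
Qed.

Lemma form_dot_is_scalar X : scalar (form_dot S X).
Proof.
move=> a Y Z; rewrite !form_dotE raise_linear mulmxDr -scalemxAr linearP /=.
by rewrite mulrDr mulrCA.
Qed.

HB.instance Definition _ X :=
  GRing.isLinear.Build C 'M[C]_4 C *%R (form_dot S X) (form_dot_is_scalar X).

Lemma form_dotDr X Y Z : form_dot S X (Y + Z) = form_dot S X Y + form_dot S X Z.
Proof. exact: linearD. Qed.

Lemma form_dotZr X a Y : form_dot S X (a *: Y) = a * form_dot S X Y.
Proof. exact: linearZ. Qed.

Lemma form_dotDl X Y Z : form_dot S (X + Y) Z = form_dot S X Z + form_dot S Y Z.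
Proof. by rewrite ![form_dot S _ Z]form_dotC form_dotDr. Qed.

Lemma form_dotZl X a Y : form_dot S (a *: X) Y = a * form_dot S X Y.
Proof. by rewrite ![form_dot S _ Y]form_dotC form_dotZr. Qed.

Definition form_dotE_lin := (form_dotDl, form_dotDr, form_dotZl, form_dotZr).

Lemma raise_wedge u v : raise S (wedge S u v) = u^T *m v - v^T *m u.
Proof.
have key a b :
    invmx (gC S) *m ((a *m gC S)^T *m (b *m gC S)) *m invmx (gC S) = a^T *m b.
  by rewrite trmx_mul gC_sym !mulmxA mulVmx ?gC_unit // mul1mx mulmxK ?gC_unit.
by rewrite /raise /wedge mulmxBr mulmxBl !key.
Qed.

Lemma mxtrace11 (A : 'M[C]_1) : \tr A = A 0 0.
Proof. by rewrite [A]mx11_scalar mxtrace_scalar mxE eqxx. Qed.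

(** Expanding both wedges gives four traces of rank-one products. Each of the two terms on the right
    arises twice, which cancels the factor 1/2 of [form_dot]. *)
Lemma wedge_dot u v w x : form_dot S (wedge S u v) (wedge S w x) =
  dot S u w * dot S v x - dot S u x * dot S v w.
Proof.
have key a b c d : \tr (((a *m gC S)^T *m (b *m gC S))^T *m (c^T *m d)) =
    dot S a c * dot S b d.
  rewrite (dotC b) trmx_mul trmxK !trmx_mul gC_sym -mulmxA mxtrace_mulC !mulmxA.
  rewrite -[c^T *m d *m _]mulmxA -[_ *m _ *m b^T]mulmxA.
  rewrite [_ *m b^T]mx11_scalar -/(dot S d b) mul_mx_scalar -!scalemxAl.
  by rewrite mxtraceZ -mulmxA mxtrace_mulC mxtrace11 mulrC.
have trB (A B : 'M[C]_4) : \tr (A - B) = \tr A - \tr B by apply: raddfB.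
have bil (A B X Y : 'M[C]_4) : \tr ((A - B)^T *m (X - Y)) =
    \tr (A^T *m X) - \tr (B^T *m X) - (\tr (A^T *m Y) - \tr (B^T *m Y)).
  by rewrite [(A - B)^T]raddfB mulmxBr trB !mulmxBl !trB.
rewrite form_dotE raise_wedge bil (key u v w) (key v u w) (key u v x) (key v u x).
by field.
Qed.

(** The inverse metric contracts the inner covectors to the scalar [dot S b c]. *)
Lemma form_mul_outer a b c d :
  form_mul S ((a *m gC S)^T *m (b *m gC S)) ((c *m gC S)^T *m (d *m gC S)) =
  dot S b c *: ((a *m gC S)^T *m (d *m gC S)).
Proof.
rewrite /form_mul !mulmxA mulmxK ?gC_unit //.
rewrite -[LHS]mulmxA [(c *m _)^T]trmx_mul gC_sym -!mulmxA [b *m _]mulmxA.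
rewrite [b *m _ *m _]mulmxA [b *m gC S *m c^T]mx11_scalar -/(dot S b c).
by rewrite mul_scalar_mx -!scalemxAr.
Qed.

Lemma form_mulDl A B X : form_mul S (A + B) X = form_mul S A X + form_mul S B X.
Proof. by rewrite /form_mul !mulmxDl. Qed.

Lemma form_mulDr X A B : form_mul S X (A + B) = form_mul S X A + form_mul S X B.
Proof. by rewrite /form_mul mulmxDr. Qed.

Lemma form_mulZl a A X : form_mul S (a *: A) X = a *: form_mul S A X.
Proof. by rewrite /form_mul -!scalemxAl. Qed.

Lemma form_mulZr a X A : form_mul S X (a *: A) = a *: form_mul S X A.
Proof. by rewrite /form_mul -scalemxAr. Qed.

End Forms.

(** Carries an eigenvector of the representing matrix back to the vector space through the basis
    [e]. *)
Lemma root_char_poly_eigenvector (F : fieldType) (vT : vectType F)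
    (phi : 'End(vT)) (e : (\dim {:vT}).-tuple vT) (x : F) :
  basis_of {:vT} e -> root (char_poly (mxof e e phi)) x ->
  exists2 v, v != 0 & phi v = x *: v.
Proof.
move=> be; rewrite -eigenvalue_root_char => /eigenvalueP[u uE u0].
exists (vecof e u); first by rewrite vecof_eq0.
by rewrite (hom_vecof e be) uE; exact: linearZ.
Qed.

(** * Coordinates on a null bivector base *)

Section NullBivectorBase.
Variables (R : rcfType) (S : spacetime_point R) (B : bivector_base R).
Local Notation C := R[i].
Local Notation U := (baseU B).
Local Notation W := (baseW B).
Local Notation V := (baseV B).

(** Self-duality and the Gram matrix only: this is common to the bases of null tetrads and to the
    transverse bases, so both share the coordinate computations below. *)
Definition null_bivector_base : Prop :=
  [/\ [/\ U \in self_dual S, W \in self_dual S & V \in self_dual S],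
      [/\ form_dot S W W = -1, form_dot S U U = 0 & form_dot S V V = 0]
    & [/\ form_dot S U W = 0, form_dot S V W = 0 & form_dot S U V = 2^-1]].

Definition lin3 (a b c : C) : 'M[C]_4 := a *: U + b *: W + c *: V.

Lemma lin3D a b c a' b' c' :
  lin3 a b c + lin3 a' b' c' = lin3 (a + a') (b + b') (c + c').
Proof. by rewrite /lin3 !scalerDl addrACA [X in X + _]addrACA. Qed.

Lemma lin3Z k a b c : k *: lin3 a b c = lin3 (k * a) (k * b) (k * c).
Proof. by rewrite /lin3 !scalerDr !scalerA. Qed.

Lemma lin3E : (U = lin3 1 0 0) * (W = lin3 0 1 0) * (V = lin3 0 0 1).
Proof. by rewrite /lin3 !scale1r !scale0r !addr0 !add0r. Qed.

Hypothesis nB : null_bivector_base.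

Lemma lin3_self_dual a b c : lin3 a b c \in self_dual S.
Proof. by case: nB => -[? ? ?] _ _; rewrite !memvD ?memvZ. Qed.

Lemma form_dot_lin3 a b c a' b' c' :
  form_dot S (lin3 a b c) (lin3 a' b' c') = 2^-1 * (a * c' + c * a') - b * b'.
Proof.
case: nB => _ [WW UU VV] [UW VW UV]; rewrite /lin3 !form_dotE_lin.
rewrite (form_dotC S W U) (form_dotC S V U) (form_dotC S W V).
rewrite WW UU VV UW VW UV; ring.
Qed.

Lemma lin3_inj a b c a' b' c' :
  lin3 a b c = lin3 a' b' c' -> [/\ a = a', b = b' & c = c'].
Proof.
move=> e; have h x y z : 2^-1 * (a * z + c * x) - b * y =
    2^-1 * (a' * z + c' * x) - b' * y.
  by rewrite -!form_dot_lin3 e.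
have two0 : (2 : C) != 0 by rewrite pnatr_eq0.
(* Pairing with 2V, -W and 2U returns the first, second and third coordinate. *)
have := (h 0 0 2, h 0 (-1) 0, h 2 0 0).
rewrite !(mulr0, addr0, subr0, add0r, mulrN1, opprK).
by rewrite !(mulrC _ 2) !mulKf //; case=> -[].
Qed.

Lemma lin3_span : \dim (self_dual S) = 3 ->
  forall X, X \in self_dual S -> exists a b c, X = lin3 a b c.
Proof.
move=> d3 X; case: (nB) => -[Us Ws Vs] _ _.
have fr : free [tuple U; W; V].
  apply/freeP => k; rewrite !big_ord_recl big_ord0 /= addr0 addrA => e.
  have /lin3_inj[k0 k1 k2] : lin3 (k ord0) (k (lift ord0 ord0))
      (k (lift ord0 (lift ord0 ord0))) = lin3 0 0 0.
    by rewrite {2}/lin3 !scale0r !addr0.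
  move=> i; case: i => -[|[|[|//]]] lt3;
    [rewrite -[RHS]k0 | rewrite -[RHS]k1 | rewrite -[RHS]k2];
    by congr k; apply: val_inj.
(* Three independent forms inside a space of dimension 3 span it. *)
have /eqP <- : <<[tuple U; W; V]>>%VS == self_dual S.
  rewrite eqEdim d3 (eqP fr) andbT; apply/span_subvP => Y.
  by rewrite !inE => /or3P[] /eqP->.
move=> XB; have [k ->] : exists k : 'I_3 -> C,
    X = \sum_i k i *: [tuple U; W; V]`_i.
  by exists (coord [tuple U; W; V] ^~ X); apply: coord_span.
exists (k ord0), (k (lift ord0 ord0)), (k (lift ord0 (lift ord0 ord0))).
by rewrite !big_ord_recl big_ord0 addr0 addrA.
Qed.

End NullBivectorBase.

Section WeylComponents.
Variables (R : rcfType) (S : spacetime_point R) (T : tensor4 R).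
Variables (B : bivector_base R).
Hypotheses (nB : null_bivector_base S B) (dim3 : \dim (self_dual S) = 3).
Local Notation C := R[i].

(** Pairing [lin3 B a b c] with U, W, V gives c/2, -b, a/2, so the tensor expansion becomes a matrix
    action. The dimension enters in the converse: every self-dual form must have coordinates. *)
Lemma weyl_componentsP (p0 p1 p2 p3 p4 : C) :
  weyl_components S T B p0 p1 p2 p3 p4 <->
  forall a b c, sd_weyl S T (lin3 B a b c) =
    lin3 B (p2 * a - 2 * p1 * b + p0 * c) (p3 * a - 2 * p2 * b + p1 * c)
           (p4 * a - 2 * p3 * b + p2 * c).
Proof.
have two0 : (2 : C) != 0 by rewrite pnatr_eq0.
have dE a b c : let X := lin3 B a b c in
    [/\ form_dot S (baseU B) X = 2^-1 * c, form_dot S (baseW B) X = - b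
      & form_dot S (baseV B) X = 2^-1 * a].
  move=> X; have [[eU eW] eV] := lin3E B.
  split; [rewrite {1}eU | rewrite {1}eW | rewrite {1}eV];
    rewrite (form_dot_lin3 nB); ring.
pose rhs X := p0 *: tens S (baseU B) (baseU B) X
  + p1 *: stens S (baseU B) (baseW B) X
  + p2 *: (stens S (baseU B) (baseV B) X + tens S (baseW B) (baseW B) X)
  + p3 *: stens S (baseW B) (baseV B) X + p4 *: tens S (baseV B) (baseV B) X.
have rhsE a b c : rhs (lin3 B a b c) =
    2^-1 *: lin3 B (p2 * a - 2 * p1 * b + p0 * c)
      (p3 * a - 2 * p2 * b + p1 * c) (p4 * a - 2 * p3 * b + p2 * c).
  have [dU dW dV] := dE a b c.
  rewrite /rhs /stens /tens dU dW dV lin3Z /lin3.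
  by apply/matrixP => r s; rewrite !mxE; field.
have -> : weyl_components S T B p0 p1 p2 p3 p4 <->
    forall X, X \in self_dual S -> 2^-1 *: sd_weyl S T X = rhs X.
  by rewrite /rhs /weyl_components; case: (B).
split=> [wc a b c|wc X Xs].
  apply: (@scalerI _ _ (2^-1)); first by rewrite invr_eq0.
  by rewrite wc ?lin3_self_dual // rhsE.
by have [a [b [c ->]]] := lin3_span nB dim3 Xs; rewrite wc rhsE.
Qed.

End WeylComponents.

(** * Products of the forms of a null frame *)

Section Outer.
Variables (R : rcfType) (S : spacetime_point R).
Implicit Types u v w x : 'rV[R[i]]_4.

Definition outer u v : 'M[R[i]]_4 := (u *m gC S)^T *m (v *m gC S).

Lemma wedgeE u v : wedge S u v = outer u v - outer v u.
Proof. by []. Qed.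
End Outer.

Section OuterAlgebra.
Variables (K : fieldType) (V : lmodType K) (E : Type).
Variables (mu : V -> V -> V) (o : E -> E -> V) (d : E -> E -> K).
Hypotheses (muDl : forall x y z, mu (x + y) z = mu x z + mu y z)
  (muDr : forall x y z, mu x (y + z) = mu x y + mu x z)
  (muZl : forall a x y, mu (a *: x) y = a *: mu x y)
  (muZr : forall a x y, mu x (a *: y) = a *: mu x y)
  (mu_o : forall u v w x, mu (o u v) (o w x) = d v w *: o u x).
(* Abstracting the 4 x 4 matrices as a space on which scalar functions separate
   points keeps unification from unfolding them. *)
Hypothesis sep : forall X Y : V, (forall ev : V -> K, {morph ev : x y / x + y} ->
  (forall a x, ev (a *: x) = a * ev x) -> ev X = ev Y) -> X = Y.
Variables (l k m n : E).
Hypotheses (ll : d l l = 0) (lk : d l k = -1) (lm : d l m = 0) (ln : d l n = 0)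
  (kl : d k l = -1) (kk : d k k = 0) (km : d k m = 0) (kn : d k n = 0)
  (ml : d m l = 0) (mk : d m k = 0) (mm : d m m = 0) (mn : d m n = 1)
  (nl : d n l = 0) (nk : d n k = 0) (nm : d n m = 1) (nn : d n n = 0).

(** Here [s] stands for 1/sqrt 2, [ii] for the imaginary unit and [n] for the conjugate of [m].
    Orthogonality replaces b b' by (ac' + ca')/2, which leaves only the antisymmetric combinations
    of the coordinates, as in a vector product. *)
Lemma outer_frame_mul (s ii a b c a' b' c' : K) :
  let w u v := o u v - o v u in
  let F x y z := x *: (- s *: w l n) + y *: (s *: (w l k + w m n))
    + z *: (s *: w k m) in
  2 != 0 :> K -> s ^+ 2 = 2^-1 -> 2^-1 * (a * c' + c * a') = b * b' ->
  (ii * (2 * s)) *: mu (F a b c) (F a' b' c') =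
  F (ii * (a * b' - b * a')) (ii / 2 * (a * c' - c * a'))
    (ii * (b * c' - c * b')).
Proof.
move=> w F two0 s2 orth; rewrite /F /w -!scaleN1r.
rewrite !(muDl, muDr, muZl, muZr) !mu_o.
rewrite ll lk lm ln kl kk km kn ml mk mm mn nl nk nm nn.
apply: sep => ev evD evZ; rewrite !(evD, evZ).
(* [Q] is the product expanded on outer products, with its factor s^2 taken out. *)
pose Q := - (a * b' - b * a') * (ev (o l n) - ev (o n l))
  + a * c' * (ev (o l k) - ev (o n m)) + c * a' * (ev (o k l) - ev (o m n))
  - b * b' * (ev (o l k) + ev (o k l) - ev (o m n) - ev (o n m))
  + (b * c' - c * b') * (ev (o k m) - ev (o m k)).
have s22 : 2 * s ^+ 2 = 1 by rewrite s2 mulfV.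
transitivity (ii * s * (2 * s ^+ 2) * Q); first by rewrite /Q; ring.
by rewrite s22 /Q -orth; field.
Qed.
End OuterAlgebra.

Section NullFrame.
Variables (R : rcfType) (S : spacetime_point R).
Variables (l k m n : 'rV[R[i]]_4).
Hypotheses (ll : dot S l l = 0) (kk : dot S k k = 0) (lk : dot S l k = -1).
Hypotheses (mm : dot S m m = 0) (nn : dot S n n = 0) (mn : dot S m n = 1).
Hypotheses (lm : dot S l m = 0) (ln : dot S l n = 0).
Hypotheses (km : dot S k m = 0) (kn : dot S k n = 0).
Local Notation C := R[i].

Definition frame_base : bivector_base R :=
  {| baseW := inv_sqrt2 R *: (wedge S l k + wedge S m n);
     baseU := - inv_sqrt2 R *: wedge S l n;
     baseV := inv_sqrt2 R *: wedge S k m |}.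

Let kl : dot S k l = -1. Proof. by rewrite dotC. Qed.
Let nm : dot S n m = 1. Proof. by rewrite dotC. Qed.
Let ml : dot S m l = 0. Proof. by rewrite dotC. Qed.
Let nl : dot S n l = 0. Proof. by rewrite dotC. Qed.
Let mk : dot S m k = 0. Proof. by rewrite dotC. Qed.
Let nk : dot S n k = 0. Proof. by rewrite dotC. Qed.
Let dots := (ll, kk, lk, kl, mm, nn, mn, nm, (lm, ln, km, kn), (ml, nl, mk, nk)).

Lemma inv_sqrt2_sqr : inv_sqrt2 R ^+ 2 = 2^-1.
Proof.
by rewrite /inv_sqrt2 -rmorphXn /= exprVn sqr_sqrtr ?ler0n // fmorphV rmorph_nat.
Qed.

Lemma frame_base_null : baseW frame_base \in self_dual S ->
  baseU frame_base \in self_dual S -> baseV frame_base \in self_dual S ->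
  null_bivector_base S frame_base.
Proof.
rewrite /null_bivector_base /frame_base /=.
have two0 : (2 : C) != 0 by rewrite pnatr_eq0.
have sE x : inv_sqrt2 R * (inv_sqrt2 R * x) = 2^-1 * x.
  by rewrite mulrA -expr2 inv_sqrt2_sqr.
have lk_lk : form_dot S (wedge S l k) (wedge S l k) = -1.
  by rewrite wedge_dot !dots; ring.
have lk_mn : form_dot S (wedge S l k) (wedge S m n) = 0.
  by rewrite wedge_dot !dots; ring.
have mn_mn : form_dot S (wedge S m n) (wedge S m n) = -1.
  by rewrite wedge_dot !dots; ring.
have ln_ln : form_dot S (wedge S l n) (wedge S l n) = 0.
  by rewrite wedge_dot !dots; ring.
have km_km : form_dot S (wedge S k m) (wedge S k m) = 0.
  by rewrite wedge_dot !dots; ring.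
have ln_lk : form_dot S (wedge S l n) (wedge S l k) = 0.
  by rewrite wedge_dot !dots; ring.
have ln_mn : form_dot S (wedge S l n) (wedge S m n) = 0.
  by rewrite wedge_dot !dots; ring.
have km_lk : form_dot S (wedge S k m) (wedge S l k) = 0.
  by rewrite wedge_dot !dots; ring.
have km_mn : form_dot S (wedge S k m) (wedge S m n) = 0.
  by rewrite wedge_dot !dots; ring.
have ln_km : form_dot S (wedge S l n) (wedge S k m) = -1.
  by rewrite wedge_dot !dots; ring.
(* From here on only the ten pairings of these four wedges matter. *)
move: (wedge S l k) (wedge S m n) (wedge S l n) (wedge S k m) lk_lk lk_mn mn_mn
  ln_ln km_km ln_lk ln_mn km_lk km_mn ln_km => LK MN LN KM.
move=> lk_lk lk_mn mn_mn ln_ln km_km ln_lk ln_mn km_lk km_mn ln_km.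
move=> Ws Us Vs; split; first by split.
- split; rewrite form_dotZl form_dotZr.
  + rewrite (form_dotDl S LK MN) (form_dotDr S LK LK MN) (form_dotDr S MN LK MN).
    by rewrite (form_dotC S MN LK) lk_lk lk_mn mn_mn sE; field.
  + by rewrite ln_ln; ring.
  + by rewrite km_km; ring.
- split; rewrite form_dotZl form_dotZr ?(form_dotDr S _ LK MN).
  + by rewrite ln_lk ln_mn; ring.
  + by rewrite km_lk km_mn; ring.
  + by rewrite ln_km mulNr sE; ring.
Qed.

Lemma form_mul_frame a b c a' b' c' : 2^-1 * (a * c' + c * a') = b * b' ->
  ('i * (Num.sqrt 2)%:C) *:
    form_mul S (lin3 frame_base a b c) (lin3 frame_base a' b' c') =
  lin3 frame_base ('i * (a * b' - b * a')) ('i / 2 * (a * c' - c * a'))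
    ('i * (b * c' - c * b')).
Proof.
have two0 : (2 : C) != 0 by rewrite pnatr_eq0.
(* Writing sqrt 2 as 2/sqrt 2 leaves a single irrational scalar, whose square is 1/2. *)
have -> : (Num.sqrt 2)%:C = 2 * inv_sqrt2 R.
  rewrite /inv_sqrt2 -[2 in RHS](rmorph_nat (real_complex R)) -rmorphM /=.
  by rewrite -{2}[2](@sqr_sqrtr R) ?ler0n // expr2 mulfK // sqrtr_eq0 lern0.
move=> orth; rewrite /lin3 /frame_base /= !wedgeE.
apply: (@outer_frame_mul _ _ _ (form_mul S) (outer S) (dot S)) => //.
- exact: form_mulDl.
- exact: form_mulDr.
- exact: form_mulZl.
- exact: form_mulZr.
- by move=> u v w x; apply: form_mul_outer.
- move=> X Y h; apply/matrixP => i j; apply: (h (fun A => A i j)) => [A A'|t A].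
    by rewrite mxE.
  by rewrite mxE.
- exact: inv_sqrt2_sqr.
Qed.
End NullFrame.

Lemma null_tetrad_frame (R : rcfType) (S : spacetime_point R)
    (l k : 'rV[R]_4) (m : 'rV[R[i]]_4) : null_tetrad S l k m ->
  null_bivector_base S (null_base S l k m) /\
  forall a b c a' b' c', 2^-1 * (a * c' + c * a') = b * b' ->
    ('i * (Num.sqrt 2)%:C) *: form_mul S (lin3 (null_base S l k m) a b c)
                                 (lin3 (null_base S l k m) a' b' c') =
    lin3 (null_base S l k m) ('i * (a * b' - b * a'))
      ('i / 2 * (a * c' - c * a')) ('i * (b * c' - c * b')).
Proof.
have dot_toC u v : dot S (toC u) (toC v) = (dotR (metric S) u v)%:C.
  by rewrite /dot /dotR /toC /gC map_trmx -!map_mxM mxE.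
move=> [[[_ ll _] [_ kk _] lk] [mm nn mn] [lm ln km kn] [Ws Us Vs]].
have {}ll : dot S (toC l) (toC l) = 0 by rewrite dot_toC ll.
have {}kk : dot S (toC k) (toC k) = 0 by rewrite dot_toC kk.
have {}lk : dot S (toC l) (toC k) = -1 by rewrite dot_toC lk rmorphN rmorph1.
(* Reality of [l], [k] and conjugacy of [m], [n] can now be forgotten: the rest concerns four
   complex vectors with given products. *)
have e : null_base S l k m = frame_base S (toC l) (toC k) m (conjv m) by [].
move: Ws Us Vs; rewrite {}e; move: (toC l) (toC k) (conjv m) ll kk lk nn mn lm ln km kn.
move=> l' k' n ll kk lk nn mn lm ln km kn Ws Us Vs.
split; first exact: (frame_base_null ll kk lk mm nn mn lm ln km kn Ws Us Vs).
exact: (form_mul_frame ll kk lk mm nn mn lm ln km kn).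
Qed.

Lemma ord3_ind (Q : 'I_3 -> Prop) : Q 0 -> Q 1 -> Q 2 -> forall i, Q i.
Proof.
move=> Q0 Q1 Q2 [[|[|[|//]]] lt3].
- by rewrite [Ordinal _](_ : _ = 0) //; apply: val_inj.
- by rewrite [Ordinal _](_ : _ = 1) //; apply: val_inj.
- by rewrite [Ordinal _](_ : _ = 2) //; apply: val_inj.
Qed.

Lemma free_eigenvectors (K : fieldType) (V : vectType K) (f : {linear V -> V})
    n (X : 'I_n -> V) (alpha : 'I_n -> K) :
  injective alpha -> (forall i, X i != 0) ->
  (forall i, f (X i) = alpha i *: X i) -> free [tuple X i | i < n].
Proof.
move=> inj X0 fX; apply/freeP => c.
under eq_bigr do rewrite -tnth_nth tnth_mktuple.
move=> cX i.
(* Applying f - alpha_j to a vanishing combination multiplies the coefficient of each X_i by alpha_i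
   - alpha_j. Doing so for all indices but [i] isolates the i-th term, with a non-zero factor. *)
have kill (s : seq 'I_n) :
    \sum_i (c i * \prod_(j <- s) (alpha i - alpha j)) *: X i = 0.
  elim: s => [|j s IH].
    by rewrite -[RHS]cX; apply: eq_bigr => h _; rewrite big_nil mulr1.
  transitivity (f 0 - alpha j *: 0 : V); last by rewrite linear0 scaler0 subr0.
  rewrite -[in f 0]IH -[in alpha j *: 0]IH linear_sum scaler_sumr -sumrB.
  apply: eq_bigr => h _; rewrite linearZ /= fX !scalerA -scalerBl big_cons.
  by congr (_ *: _); ring.
have := kill (enum (predC1 i)); rewrite (bigD1 i) //= [X in _ + X]big1 ?addr0 => [|h hi].
  move/eqP; rewrite scaler_eq0 (negPf (X0 i)) orbF mulf_eq0 => /orP[/eqP//|].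
  rewrite prodf_seq_eq0 => /hasP[j]; rewrite mem_enum inE subr_eq0 => ji.
  by rewrite (inj_eq inj) eq_sym (negPf ji).
rewrite (bigD1_seq h) ?enum_uniq ?mem_enum //=.
by rewrite subrr mul0r mulr0 scale0r.
Qed.

(** * The Weyl endomorphism in coordinates: symmetry and eigenvalues *)

Section Eigen.
Variables (R : rcfType) (S : spacetime_point R) (T : tensor4 R).
Variables (B : bivector_base R).
Hypotheses (nB : null_bivector_base S B) (dim3 : \dim (self_dual S) = 3).
Local Notation C := R[i].
Variables (p0 p1 p2 p3 p4 : C).
Hypothesis wE : forall a b c, sd_weyl S T (lin3 B a b c) =
    lin3 B (p2 * a - 2 * p1 * b + p0 * c) (p3 * a - 2 * p2 * b + p1 * c)
           (p4 * a - 2 * p3 * b + p2 * c).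

Lemma lin3_eq0 a b c : lin3 B a b c = 0 -> [/\ a = 0, b = 0 & c = 0].
Proof. by move=> e; apply: (lin3_inj nB); rewrite e /lin3 !scale0r !addr0. Qed.

Lemma form_dot_nondegenerate X : X \in self_dual S ->
  (forall Y, Y \in self_dual S -> form_dot S X Y = 0) -> X = 0.
Proof.
have two0 : (2 : C) != 0 by rewrite pnatr_eq0.
move=> /(lin3_span nB dim3)[a [b [c ->]]] h.
have h' x y z : 2^-1 * (a * z + c * x) - b * y = 0.
  by rewrite -(form_dot_lin3 nB) h // lin3_self_dual.
have -> : a = 0 by rewrite -(h' 0 0 2); field.
have -> : b = 0 by rewrite -(h' 0 (-1) 0); ring.
have -> : c = 0 by rewrite -(h' 2 0 0); field.
by rewrite /lin3 !scale0r !addr0.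
Qed.

Lemma sd_weyl_sym X Y : X \in self_dual S -> Y \in self_dual S ->
  form_dot S (sd_weyl S T X) Y = form_dot S X (sd_weyl S T Y).
Proof.
have two0 : (2 : C) != 0 by rewrite pnatr_eq0.
move=> /(lin3_span nB dim3)[a [b [c ->]]] /(lin3_span nB dim3)[a' [b' [c' ->]]].
by rewrite !wE !(form_dot_lin3 nB); field.
Qed.

Lemma eigenvectors_orthogonal x y X Y : x != y ->
  X \in self_dual S -> Y \in self_dual S ->
  sd_weyl S T X = x *: X -> sd_weyl S T Y = y *: Y -> form_dot S X Y = 0.
Proof.
move=> xy Xs Ys fX fY; apply/eqP; have := sd_weyl_sym Xs Ys.
rewrite fX fY form_dotZl form_dotZr => /eqP.
by rewrite -subr_eq0 -mulrBl mulf_eq0 subr_eq0 (negPf xy).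
Qed.

(** An eigenvector is a non-zero row in the kernel of the coordinate matrix of C - x, whose
    determinant is the opposite of this cubic. *)
Lemma sd_weyl_eigenP (x : C) :
  (exists X, [/\ X \in self_dual S, X != 0 & sd_weyl S T X = x *: X]) <->
  x ^+ 3 - (p0 * p4 - 4 * p1 * p3 + 3 * p2 ^+ 2) * x
    - 2 * \det (\matrix_(r < 3, c < 3)
             nth 0 (nth [::] [:: [:: p4; p3; p2];
                                 [:: p3; p2; p1];
                                 [:: p2; p1; p0]] r) c) = 0.
Proof.
(* The rows are the coordinates of the images of U, W, V under C - x, so [A] acts on coordinate rows
   from the right. *)
pose A : 'M[C]_3 := \matrix_(r < 3, s < 3) nth 0 (nth [::]
  [:: [:: p2 - x; p3; p4]; [:: - 2 * p1; - 2 * p2 - x; - 2 * p3];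
      [:: p0; p1; p2 - x]] r) s.
have detA : \det A = - (x ^+ 3 - (p0 * p4 - 4 * p1 * p3 + 3 * p2 ^+ 2) * x
    - 2 * \det (\matrix_(r < 3, c < 3)
             nth 0 (nth [::] [:: [:: p4; p3; p2];
                                 [:: p3; p2; p1];
                                 [:: p2; p1; p0]] r) c)).
  by rewrite !det_mx3; ring.
have vA (v : 'rV[C]_3) :
    let w i := v 0 i in let X := lin3 B (w ord0) (w (lift ord0 ord0))
       (w (lift ord0 (lift ord0 ord0))) in
    let z i := (v *m A) 0 i in
    sd_weyl S T X - x *: X = lin3 B (z ord0) (z (lift ord0 ord0))
       (z (lift ord0 (lift ord0 ord0))).
  rewrite /= wE -(scaleNr x) lin3Z lin3D; congr (lin3 _ _ _ _);
    rewrite mxE !big_ord_recl big_ord0 !mxE /=; ring.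
split=> [[X [Xs X0 fX]]|chi].
  have [a [b [c XE]]] := lin3_span nB dim3 Xs.
  suff /det0P : exists2 v : 'rV_3, v != 0 & v *m A = 0.
    by rewrite detA oppr_eq0 => /eqP.
  pose v : 'rV[C]_3 := \row_i nth 0 [:: a; b; c] i; exists v.
    apply: contra X0 => /eqP v0; have := fun i => congr1 (fun u : 'rV_3 => u 0 i) v0.
    move=> v0i.
    have := (v0i ord0, v0i (lift ord0 ord0), v0i (lift ord0 (lift ord0 ord0))).
    by rewrite !mxE /= XE => -[[-> ->] ->]; rewrite /lin3 !scale0r !addr0.
  have := vA v; rewrite /= [v 0 ord0]mxE [v 0 (lift ord0 ord0)]mxE.
  rewrite [v 0 (lift ord0 (lift _ _))]mxE /= -XE fX subrr.
  move=> /esym/lin3_eq0[z0 z1 z2].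
  apply/rowP => i; rewrite [RHS]mxE.
  by case: i => [[|[|[|//]]] lt3];
     [rewrite -[RHS]z0 | rewrite -[RHS]z1 | rewrite -[RHS]z2];
     congr (_ _ _); apply: val_inj.
have /det0P[v vn0 vA0] : \det A == 0 by rewrite detA chi oppr0.
have z0 i : (0 : 'rV[C]_3) 0 i = 0 by rewrite mxE.
have := vA v; rewrite /= vA0 !z0.
set X := lin3 _ _ _ _ => fX; exists X; split.
- exact: lin3_self_dual.
- apply: contra vn0 => /eqP/lin3_eq0[v0 v1 v2].
  apply/eqP/rowP => i; rewrite [RHS]mxE.
  by case: i => [[|[|[|//]]] lt3];
     [rewrite -[RHS]v0 | rewrite -[RHS]v1 | rewrite -[RHS]v2];
     congr (_ _ _); apply: val_inj.
- by apply/eqP; rewrite -subr_eq0 fX /lin3 !scale0r !addr0.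
Qed.
End Eigen.

(** * Principal transverse bases and their components *)

Lemma transverse_combination (K : fieldType) (V : lmodType K) (X Y Z : V)
    (ii a b c : K) :
  a *: ((ii / 2) *: (Y + ii *: Z)) + b *: X + c *: ((ii / 2) *: (Y - ii *: Z)) =
  (ii / 2 * (a + c)) *: Y + (ii / 2 * ii * (a - c)) *: Z + b *: X.
Proof.
rewrite !(scalerDr, scalerA, scalerN) -!scaleNr.
rewrite [LHS]addrAC [in LHS]addrACA -!scalerDl.
by congr (_ *: _ + _ *: _ + _); ring.
Qed.

(** The coordinates of Y and Z are proportional to a + c and a - c, which [f] scales by [y] and [z].
    Solving for the new [a] and [c] produces the half-sums and half-differences. *)
Lemma transverse_eigen (K : fieldType) (V : lmodType K) (f : {linear V -> V})
    (X Y Z : V) (x y z ii a b c : K) :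
  let F a b c := (ii / 2 * (a + c)) *: Y + (ii / 2 * ii * (a - c)) *: Z + b *: X in
  2 != 0 :> K -> f X = x *: X -> f Y = y *: Y -> f Z = z *: Z ->
  f (F a b c) = F (2^-1 * ((y + z) * a + (y - z) * c)) (x * b)
                  (2^-1 * ((y - z) * a + (y + z) * c)).
Proof.
move=> F two0 fX fY fZ; rewrite /F 2!linearD 3!linearZ /= fX fY fZ !scalerA.
by congr (_ *: _ + _ *: _ + _ *: _); field.
Qed.

Section Transverse.
Variables (R : rcfType) (S : spacetime_point R) (T : tensor4 R).
Local Notation C := R[i].
Variables (alpha : 'I_3 -> C) (P : 'I_3 -> 'M[C]_4).
Hypothesis Ps : forall i, P i \in self_dual S.
Hypothesis Pn : forall i, form_dot S (P i) (P i) = -1.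
Hypothesis Po : forall i j, i != j -> form_dot S (P i) (P j) = 0.

Lemma transverse_lin3 i a b c : lin3 (transverse_base P i) a b c =
  ('i / 2 * (a + c)) *: P (ordS i)
  + ('i / 2 * 'i * (a - c)) *: P (ordS (ordS i)) + b *: P i.
Proof. exact: transverse_combination. Qed.

Lemma ordS3_neq (i : 'I_3) : [/\ ordS i != i, ordS (ordS i) != i
  & ordS (ordS i) != ordS i].
Proof. by elim/ord3_ind: i. Qed.

Lemma form_dot_pair a b X Y a' b' X' Y' :
  form_dot S (a *: (X + b *: Y)) (a' *: (X' + b' *: Y')) =
  a * a' * (form_dot S X X' + b' * form_dot S X Y'
            + b * form_dot S Y X' + b * b' * form_dot S Y Y').
Proof.
rewrite form_dotZl form_dotZr (form_dotDl S X (b *: Y)).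
rewrite (form_dotDr S X X') (form_dotDr S (b *: Y) X').
rewrite (form_dotZr S X) (form_dotZl S Y b X') (form_dotZl S Y b (b' *: Y')).
rewrite (form_dotZr S Y).
move: (form_dot S X X') (form_dot S X Y') (form_dot S Y X') (form_dot S Y Y').
by move=> u v w x; ring.
Qed.

(** U_i and V_i are null because 1 + i^2 = 0, and (U_i, V_i) = (i/2)^2 (-2) = 1/2. *)
Lemma transverse_base_null i : null_bivector_base S (transverse_base P i).
Proof.
have two0 : (2 : C) != 0 by rewrite pnatr_eq0.
have [ji hi hj] := ordS3_neq i; set j := ordS i in ji hi hj *.
rewrite /null_bivector_base /= -/j; set h := ordS j in hi hj *.
have ii := sqrCi C.
split.
- have mem a b : a *: (P j + b *: P h) \in self_dual S.
    by rewrite memvZ // memvD ?Ps // memvZ ?Ps.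
  by split; [exact: mem | exact: Ps | rewrite -(scaleNr 'i%R); exact: mem].
- split; first exact: Pn.
    rewrite form_dot_pair !Pn Po ?(eq_sym j) // Po //.
    by move: ii; move: 'i%R => q ii; ring: ii.
  rewrite -(scaleNr 'i%R) form_dot_pair !Pn Po ?(eq_sym j) // Po //.
  by move: ii; move: 'i%R => q ii; ring: ii.
- split.
  + rewrite form_dotZl (form_dotDl S (P j)) (form_dotZl S (P h)) !Po //; ring.
  + rewrite -(scaleNr 'i%R) form_dotZl (form_dotDl S (P j)) (form_dotZl S (P h)).
    rewrite !Po //; ring.
  + rewrite -(scaleNr 'i%R) form_dot_pair !Pn Po ?(eq_sym j) // Po //.
    by move: ii; move: 'i%R => q ii; field: ii.
Qed.

Hypothesis dim3 : \dim (self_dual S) = 3.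
Hypothesis fP : forall i, sd_weyl S T (P i) = alpha i *: P i.
Hypothesis tr0 : alpha 0 + alpha 1 + alpha 2 = 0.

Lemma sd_weyl_transverse i a b c :
  let j := ordS i in let h := ordS j in
  sd_weyl S T (lin3 (transverse_base P i) a b c) = lin3 (transverse_base P i)
    (2^-1 * ((alpha j + alpha h) * a + (alpha j - alpha h) * c)) (alpha i * b)
    (2^-1 * ((alpha j - alpha h) * a + (alpha j + alpha h) * c)).
Proof.
have two0 : (2 : C) != 0 by rewrite pnatr_eq0.
move=> j h; rewrite !transverse_lin3 -/j -/h.
exact: (transverse_eigen 'i%R a b c two0 (fP i) (fP j) (fP h)).
Qed.

(** Compares [weyl_componentsP] with the diagonal action. Vanishing trace turns (alpha_j +
    alpha_k)/2 into -alpha_i/2, which makes the entry on U_i, V_i agree with the one on W_i. *)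
Lemma transverse_components i q0 q1 q2 q3 q4 :
  let j := ordS i in let h := ordS j in
  weyl_components S T (transverse_base P i) q0 q1 q2 q3 q4 <->
  (q1 = 0 /\ q3 = 0 /\ q2 = - 2^-1 * alpha i /\
   q0 = (alpha j - alpha h) / 2 /\ q4 = (alpha j - alpha h) / 2).
Proof.
have two0 : (2 : C) != 0 by rewrite pnatr_eq0.
have [S0 S1 S2] : [/\ ordS 0 = 1 :> 'I_3, ordS 1 = 2 :> 'I_3 & ordS 2 = 0 :> 'I_3].
  by split; apply: val_inj.
have sum0 : forall u, alpha (ordS u) + alpha (ordS (ordS u)) = - alpha u.
  move=> u; apply/eqP; rewrite -addr_eq0 -tr0; apply/eqP.
  by move: u; apply: ord3_ind; rewrite ?(S0, S1, S2); ring.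
move=> j h; have {}sum0 : alpha j + alpha h = - alpha i := sum0 i.
have nB := transverse_base_null i; rewrite (weyl_componentsP T nB dim3).
have e : (forall a b c, sd_weyl S T (lin3 (transverse_base P i) a b c) =
    lin3 (transverse_base P i) (q2 * a - 2 * q1 * b + q0 * c)
      (q3 * a - 2 * q2 * b + q1 * c) (q4 * a - 2 * q3 * b + q2 * c)) <->
  forall a b c, [/\ 2^-1 * ((alpha j + alpha h) * a + (alpha j - alpha h) * c) =
      q2 * a - 2 * q1 * b + q0 * c,
    alpha i * b = q3 * a - 2 * q2 * b + q1 * c
    & 2^-1 * ((alpha j - alpha h) * a + (alpha j + alpha h) * c) =
      q4 * a - 2 * q3 * b + q2 * c].
  split=> H a b c.
    by have := sd_weyl_transverse i a b c; rewrite H => /esym/(lin3_inj nB).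
  by rewrite sd_weyl_transverse; have [-> -> ->] := H a b c.
rewrite e {e} sum0; move: (alpha i) (alpha j - alpha h) => x y; split=> [H|].
  (* The images of U_i and V_i already contain all five components. *)
  have [h1 h2 h3] := H 1 0 0; have [h4 h5 h6] := H 0 0 1.
  have e1 : q1 = q3 * 0 - 2 * q2 * 0 + q1 * 1 by ring.
  have e3 : q3 = q3 * 1 - 2 * q2 * 0 + q1 * 0 by ring.
  have e2 : q2 = q2 * 1 - 2 * q1 * 0 + q0 * 0 by ring.
  have e0 : q0 = q2 * 0 - 2 * q1 * 0 + q0 * 1 by ring.
  have e4 : q4 = q4 * 1 - 2 * q3 * 0 + q2 * 0 by ring.
  rewrite -{}h1 in e2; rewrite -{}h2 in e3; rewrite -{}h3 in e4.
  rewrite -{}h4 in e0; rewrite -{}h5 in e1.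
  by rewrite e0 e1 e2 e3 e4; do 4?split; ring.
by move=> [-> [-> [-> [-> ->]]]] a b c; split; field.
Qed.
End Transverse.

(** * Cardano's formula and distinctness of the roots *)

Lemma cardano (K : fieldType) (I J sq beta s3 ii x : K) :
  let alpha1 := beta + I / (3 * beta) in
  let alpha2 := - 2^-1 * ((1 - ii * s3) * beta + (1 + ii * s3) * (I / (3 * beta))) in
  let alpha3 := - 2^-1 * ((1 + ii * s3) * beta + (1 - ii * s3) * (I / (3 * beta))) in
  2 != 0 :> K -> 3 != 0 :> K -> beta != 0 -> ii ^+ 2 = -1 -> s3 ^+ 2 = 3 ->
  sq ^+ 2 = J ^+ 2 - I ^+ 3 / 27 -> beta ^+ 3 = J + sq ->
  x ^+ 3 - I * x - 2 * J = (x - alpha1) * (x - alpha2) * (x - alpha3).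
Proof.
move=> alpha1 alpha2 alpha3 two0 three0 b0 ii2 s32 sq2 b3.
have n27 : 27 != 0 :> K by rewrite (_ : 27 = 3 ^+ 3) ?expf_neq0 //; ring.
(* The roots are beta + delta and its two twists by the cube roots of unity (-1 +- i sqrt 3)/2; it
   remains to see that 3 beta delta = I and beta^3 + delta^3 = 2J. *)
pose delta := I / (3 * beta).
have IE : I = 3 * beta * delta by rewrite /delta; field; rewrite b0.
have JE : 2 * J = beta ^+ 3 + delta ^+ 3.
  have b30 : beta ^+ 3 != 0 by rewrite expf_neq0.
  (* After multiplication by beta^3 the claim rests on (beta delta)^3 = (J + sq)(J - sq). *)
  apply: (mulfI b30); rewrite mulrDr -[_ * delta ^+ 3]exprMn.
  have -> : beta * delta = I / 3 by rewrite IE; field.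
  have -> : (I / 3) ^+ 3 = J ^+ 2 - sq ^+ 2 by rewrite sq2; field; rewrite n27.
  by rewrite b3; ring.
have w2 : (ii * s3) ^+ 2 = -3 by rewrite exprMn ii2 s32 mulN1r.
rewrite JE [in LHS]IE /alpha1 /alpha2 /alpha3 -/delta.
move: (ii * s3) w2 => w w2.
(* The product of the last two factors depends on [w] only through w^2, which is then replaced by
   -3. *)
transitivity ((x - (beta + delta)) * (x ^+ 2 + (beta + delta) * x
  + 4^-1 * ((1 - w ^+ 2) * (beta ^+ 2 + delta ^+ 2)
            + 2 * (1 + w ^+ 2) * (beta * delta)))).
  have four : 4 = 2 * 2 :> K by ring.
  by rewrite w2; field; rewrite four mulf_neq0.
have four : 4 = 2 * 2 :> K by ring.
by field; rewrite two0 four mulf_neq0.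
Qed.

(** Three distinct values contained in a list of length three force that list to be duplicate-free;
    no matching of [x], [y], [z] with the roots is needed. *)
Lemma cubic_roots_distinct (K : fieldType) (a : 'I_3 -> K) (x y z : K) :
  x != y -> y != z -> z != x ->
  (forall t, t \in [:: x; y; z] -> (t - a 0) * (t - a 1) * (t - a 2) = 0) ->
  injective a.
Proof.
move=> xy yz zx root.
have mem t : t \in [:: x; y; z] -> t \in [:: a 0; a 1; a 2].
  move/root/eqP; rewrite !mulf_eq0 !subr_eq0 !inE.
  by case/orP => [/orP[]|] ->; rewrite ?orbT.
have : uniq [:: a 0; a 1; a 2].
  have u : uniq [:: x; y; z] by rewrite /= !inE (eq_sym x z) !negb_or xy yz zx.
  exact: (leq_size_uniq u mem).
rewrite /= !inE negb_or => /and3P[/andP[a01 a02] a12 _].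
have key i j : i != j -> a i != a j.
  move: i j; apply: ord3_ind; apply: ord3_ind => //= _; rewrite // eq_sym //.
by move=> i j /eqP; apply: contraTeq => /key.
Qed.

Lemma scalar_span_eq0 (K : fieldType) (V : vectType K) (f : {scalar V}) n
    (X : 'I_n -> V) : (forall i, f (X i) = 0) ->
  forall Y, Y \in <<[tuple X i | i < n]>>%VS -> f Y = 0.
Proof.
move=> fX Y /coord_span ->; rewrite linear_sum big1 // => j _.
by rewrite -tnth_nth tnth_mktuple linearZ /= fX mulr0.
Qed.

Lemma scale_eigenvector (K : fieldType) (V : lmodType K) (f : {linear V -> V})
    (v x : K) (X : V) : v != 0 -> f (v *: X) = x *: (v *: X) -> f X = x *: X.
Proof.
move=> v0 fX; apply: (scalerI v0).
by rewrite -linearZ fX !scalerA mulrC.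
Qed.

(** * Consequences of type I *)

Section TypeI.
Variables (R : rcfType) (S : spacetime_point R) (T : tensor4 R).
Local Notation C := R[i].
Hypothesis hI : type_I S T.

(** The characteristic polynomial has degree the dimension of the space, and type I makes it a
    cubic; this avoids solving the self-duality equations. *)
Lemma type_I_dim : \dim (self_dual S) = 3.
Proof.
have [x [y [z [_ _ _ chi]]]] := hI.
have := congr1 (fun p : {poly C} => size p) chi.
rewrite /characteristic_poly /= size_char_poly.
have -> : ('X - x%:P) * ('X - y%:P) * ('X - z%:P) =
    \prod_(t <- [:: x; y; z]) ('X - t%:P) :> {poly C}.
  by rewrite !big_cons big_nil mulr1 mulrA.
by rewrite size_prod_XsubC dimvf => -[].
Qed.

Lemma type_I_eigenvectors :
  (forall X, X \in self_dual S -> sd_weyl S T X \in self_dual S) ->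
  exists x y z : C, [/\ x != y, y != z, z != x &
    forall t, t \in [:: x; y; z] ->
      exists X, [/\ X \in self_dual S, X != 0 & sd_weyl S T X = t *: X]].
Proof.
move=> stable; have [x [y [z [xy yz zx chi]]]] := hI.
exists x, y, z; split=> // t txyz.
have : root (characteristic_poly S T) t.
  rewrite chi !rootM !root_XsubC; move: txyz; rewrite !inE.
  by case/or3P => ->; rewrite ?orbT.
case/(root_char_poly_eigenvector (vbasisP _)) => v v0.
rewrite lfunE /= => fv; exists (vsval v).
have vs : vsval v \in self_dual S by apply: subvsP.
split=> //.
(* By stability the projection inside [sd_weyl_end] does not move the image. *)
by rewrite -[LHS](vsprojK (stable _ vs)) fv.
Qed.
End TypeI.

(** Lagrange's identity for the pairing [G] in null coordinates. With [ii] squaring to -1, two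
    orthogonal forms of square -1 yield a third of square -1. *)
Lemma cross_product (K : fieldType) (ii a b c a' b' c' : K) :
  let G a b c a' b' c' := 2^-1 * (a * c' + c * a') - b * b' in
  let u := ii * (a * b' - b * a') in
  let v := ii / 2 * (a * c' - c * a') in
  let w := ii * (b * c' - c * b') in
  2 != 0 :> K ->
  [/\ G u v w u v w =
        ii ^+ 2 * (G a b c a b c * G a' b' c' a' b' c' - G a b c a' b' c' ^+ 2),
      G u v w a b c = 0 & G u v w a' b' c' = 0].
Proof.
move=> G u v w two0; rewrite /u /v /w /G.
have four0 : 4 != 0 :> K by rewrite (_ : 4 = 2 * 2) ?mulf_neq0 //; ring.
by split; field; rewrite ?two0 ?four0.
Qed.

(** * Existence of an oriented triple of principal 2-forms *)

Section Existence.
Variables (R : rcfType) (S : spacetime_point R) (T : tensor4 R).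
Variables (B : bivector_base R).
Hypotheses (nB : null_bivector_base S B) (dim3 : \dim (self_dual S) = 3).
Local Notation C := R[i].
Hypothesis mulB : forall a b c a' b' c', 2^-1 * (a * c' + c * a') = b * b' ->
    ('i * (Num.sqrt 2)%:C) *: form_mul S (lin3 B a b c) (lin3 B a' b' c') =
    lin3 B ('i * (a * b' - b * a')) ('i / 2 * (a * c' - c * a'))
           ('i * (b * c' - c * b')).
Variables (p0 p1 p2 p3 p4 : C).
Hypothesis wE : forall a b c, sd_weyl S T (lin3 B a b c) =
    lin3 B (p2 * a - 2 * p1 * b + p0 * c) (p3 * a - 2 * p2 * b + p1 * c)
           (p4 * a - 2 * p3 * b + p2 * c).
Variable alpha : 'I_3 -> C.
Hypothesis inj : injective alpha.
Hypothesis eig : forall i, exists X,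
  [/\ X \in self_dual S, X != 0 & sd_weyl S T X = alpha i *: X].

Lemma exists_principal_forms : exists P, principal_forms S T alpha P.
Proof.
have [X XP] := fin_all_exists eig.
have Xs i : X i \in self_dual S by case: (XP i).
have X0 i : X i != 0 by case: (XP i).
have fX i : sd_weyl S T (X i) = alpha i *: X i by case: (XP i).
have Xo i j : i != j -> form_dot S (X i) (X j) = 0.
  rewrite -(inj_eq inj) => ij.
  exact: (eigenvectors_orthogonal nB dim3 wE ij (Xs i) (Xs j) (fX i) (fX j)).
have Xspan : <<[tuple X i | i < 3]>>%VS = self_dual S.
  apply/eqP; rewrite eqEdim dim3 (eqP (free_eigenvectors inj X0 fX)).
  rewrite size_tuple leqnn andbT.
  by apply/span_subvP => Y /mapP[i _ ->].
(* A null [X i] would be orthogonal to all three eigenvectors, hence to the whole space they span,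
   against nondegeneracy. *)
have Xn i : form_dot S (X i) (X i) != 0.
  apply: contraNneq (X0 i) => Xii; apply/eqP.
  apply: (form_dot_nondegenerate nB dim3 (Xs i)) => Y; rewrite -{1}Xspan => YX.
  have Xij j : form_dot S (X i) (X j) = 0 by have [<-|/Xo] := eqVneq i j.
  exact: (@scalar_span_eq0 _ _ (form_dot S (X i)) 3 X Xij Y YX).
pose N i : 'M[C]_4 := (sqrtC (- form_dot S (X i) (X i)))^-1 *: X i.
have Ns i : N i \in self_dual S by rewrite memvZ ?Xs.
have Nn i : form_dot S (N i) (N i) = -1.
  rewrite form_dotZl form_dotZr mulrA -expr2 exprVn sqrtCK invrN mulNr.
  by rewrite mulVf.
have No i j : i != j -> form_dot S (N i) (N j) = 0.
  have aux u v Y Z : form_dot S Y Z = 0 -> form_dot S (u *: Y) (v *: Z) = 0.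
    by move=> YZ; rewrite form_dotZl form_dotZr YZ; ring.
  by move=> ij; apply: aux; apply: Xo.
have fN i : sd_weyl S T (N i) = alpha i *: N i.
  by rewrite linearZ /= fX !scalerA mulrC.
have [a [b [c N0E]]] := lin3_span nB dim3 (Ns 0).
have [a' [b' [c' N1E]]] := lin3_span nB dim3 (Ns 1).
(* Normalising [X 2] would fix the third form only up to sign; the product has the orientation built
   in, and must instead be shown to be an eigenvector. *)
pose P2 := ('i * (Num.sqrt 2)%:C) *: form_mul S (N 0) (N 1).
have o01 : 2^-1 * (a * c' + c * a') - b * b' = 0.
  by rewrite -(form_dot_lin3 nB) -N0E -N1E No.
have n0 : 2^-1 * (a * c + c * a) - b * b = -1.
  by rewrite -(form_dot_lin3 nB) -N0E Nn.
have n1 : 2^-1 * (a' * c' + c' * a') - b' * b' = -1.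
  by rewrite -(form_dot_lin3 nB) -N1E Nn.
have P2E : P2 = lin3 B ('i * (a * b' - b * a')) ('i / 2 * (a * c' - c * a'))
           ('i * (b * c' - c * b')).
  by rewrite /P2 N0E N1E mulB //; apply/eqP; rewrite -subr_eq0 o01.
have two0 : (2 : C) != 0 by rewrite pnatr_eq0.
have [cn c0 c1] := cross_product 'i%R a b c a' b' c' two0.
have P2s : P2 \in self_dual S by rewrite P2E lin3_self_dual.
have P2n : form_dot S P2 P2 = -1.
  by rewrite P2E (form_dot_lin3 nB) cn n0 n1 o01 sqrCi; ring.
have P20 : form_dot S P2 (N 0) = 0 by rewrite P2E N0E (form_dot_lin3 nB) c0.
have P21 : form_dot S P2 (N 1) = 0 by rewrite P2E N1E (form_dot_lin3 nB) c1.
pose P (i : 'I_3) := nth 0 [:: N 0; N 1; P2] i.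
have N01 : form_dot S (N 0) (N 1) = 0 by apply: No.
have Ps : forall i, P i \in self_dual S.
  by apply: ord3_ind; [exact: Ns | exact: Ns | exact: P2s].
have Pn : forall i, form_dot S (P i) (P i) = -1.
  by apply: ord3_ind; [exact: Nn | exact: Nn | exact: P2n].
have Po : forall i j, i != j -> form_dot S (P i) (P j) = 0.
  have Q10 : form_dot S (N 1) (N 0) = 0 by rewrite form_dotC.
  have Q02 : form_dot S (N 0) P2 = 0 by rewrite form_dotC.
  have Q12 : form_dot S (N 1) P2 = 0 by rewrite form_dotC.
  apply: ord3_ind; apply: ord3_ind => ij;
    [by case/eqP: ij | exact: N01 | exact: Q02 | exact: Q10 | by case/eqP: ij
    | exact: Q12 | exact: P20 | exact: P21 | by case/eqP: ij].
(* The transverse base built on [N 0] spans, so [X 2] is a combination of [N 0], [N 1], [P2].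
   Orthogonality to [N 0] and [N 1] then leaves a non-zero multiple of [P2]. *)
have nP := transverse_base_null Ps Pn Po 0.
have [u [v [y X2E]]] : exists u v y, X 2 = u *: N 1 + v *: P2 + y *: N 0.
  have [x [y [z ->]]] := lin3_span nP dim3 (Xs 2); rewrite transverse_lin3.
  by exists ('i / 2 * (x + z)), ('i / 2 * 'i * (x - z)), y.
have X2N i : i != 2 -> form_dot S (X 2) (N i) = 0.
  by move=> i2; rewrite form_dotZr (Xo 2 i) ?mulr0 // eq_sym.
have dotX2 Q : form_dot S (X 2) Q =
    u * form_dot S (N 1) Q + v * form_dot S P2 Q + y * form_dot S (N 0) Q.
  have dot3 Y Z W : form_dot S (u *: Y + v *: Z + y *: W) Q =
      u * form_dot S Y Q + v * form_dot S Z Q + y * form_dot S W Q.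
    rewrite (form_dotDl S (u *: Y + v *: Z)) (form_dotDl S (u *: Y)).
    by rewrite 3!form_dotZl.
  by rewrite X2E dot3.
have y0 : y = 0.
  have := dotX2 (N 0); rewrite X2N // P20 Nn (form_dotC S (N 1)) N01.
  by rewrite !mulr0 !add0r mulrN1 => /esym/eqP; rewrite oppr_eq0 => /eqP.
have u0 : u = 0.
  have := dotX2 (N 1); rewrite X2N // P21 Nn N01.
  by rewrite !mulr0 !addr0 mulrN1 => /esym/eqP; rewrite oppr_eq0 => /eqP.
move: X2E; rewrite y0 u0 !scale0r addr0 add0r => X2E.
have v0 : v != 0 by apply: contraNneq (X0 2) => v0; rewrite X2E v0 scale0r.
have fP2 : sd_weyl S T P2 = alpha 2 *: P2.
  by apply: (scale_eigenvector v0); rewrite -X2E; exact: fX.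
exists P; split=> //.
by apply: ord3_ind; [exact: fN | exact: fN | exact: fP2].
Qed.
End Existence.

Theorem theorem1 (R : realType) (S : spacetime_point R) (T : tensor4 R)
    (l k : 'rV[R]_4) (m : 'rV[R[i]]_4) (Psi0 Psi1 Psi2 Psi3 Psi4 : R[i])
    (hW : weyl_tensor S T) (hI : type_I S T) (hnull : null_tetrad S l k m)
    (hPsi : weyl_components S T (null_base S l k m)
              Psi0 Psi1 Psi2 Psi3 Psi4) :
  let I := Psi0 * Psi4 - 4 * Psi1 * Psi3 + 3 * Psi2 ^+ 2 in
  let J := \det (\matrix_(r < 3, c < 3)
             nth 0 (nth [::] [:: [:: Psi4; Psi3; Psi2];
                                 [:: Psi3; Psi2; Psi1];
                                 [:: Psi2; Psi1; Psi0]] r) c) in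
  forall sq beta : R[i],
  sq ^+ 2 = J ^+ 2 - I ^+ 3 / 27 ->
  beta ^+ 3 = J + sq ->
  beta != 0 ->
  let s3 := (Num.sqrt (3 : R))%:C in
  let alpha1 := beta + I / (3 * beta) in
  let alpha2 := - 2^-1 * ((1 - 'i * s3) * beta
                          + (1 + 'i * s3) * (I / (3 * beta))) in
  let alpha3 := - 2^-1 * ((1 + 'i * s3) * beta
                          + (1 - 'i * s3) * (I / (3 * beta))) in
  let alpha := fun i : 'I_3 => nth 0 [:: alpha1; alpha2; alpha3] i in
  (exists P : 'I_3 -> 'M[R[i]]_4, principal_forms S T alpha P) /\
  (forall P : 'I_3 -> 'M[R[i]]_4, principal_forms S T alpha P ->
   forall i : 'I_3,
   let j := ordS i in
   let h := ordS j in
   forall q0 q1 q2 q3 q4 : R[i],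
     weyl_components S T (transverse_base P i) q0 q1 q2 q3 q4 <->
     (q1 = 0 /\ q3 = 0 /\ q2 = - 2^-1 * alpha i /\
      q0 = (alpha j - alpha h) / 2 /\ q4 = (alpha j - alpha h) / 2)).
Proof.
move=> I J sq beta sq2 beta3 beta0 s3 alpha1 alpha2 alpha3 alpha.
have two0 : (2 : R[i]) != 0 by rewrite pnatr_eq0.
have three0 : (3 : R[i]) != 0 by rewrite pnatr_eq0.
have s32 : s3 ^+ 2 = 3.
  by rewrite /s3 -rmorphXn /= sqr_sqrtr ?ler0n // rmorph_nat.
have dim3 := type_I_dim hI.
have [nB mulB] := null_tetrad_frame hnull.
have wE := (weyl_componentsP T nB dim3 _ _ _ _ _).1 hPsi.
have stable X : X \in self_dual S -> sd_weyl S T X \in self_dual S.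
  move=> /(lin3_span nB dim3)[a [b [c ->]]]; rewrite wE.
  exact: lin3_self_dual.
have chi x : x ^+ 3 - I * x - 2 * J =
    (x - alpha 0) * (x - alpha 1) * (x - alpha 2).
  exact: (cardano x two0 three0 beta0 (sqrCi _) s32 sq2 beta3).
(* The three distinct eigenvalues given by type I are roots of the Cardano factorisation, so they
   all occur among the [alpha i]. *)
have inj : injective alpha.
  have [x [y [z [xy yz zx ev]]]] := type_I_eigenvectors hI stable.
  apply: (cubic_roots_distinct xy yz zx) => t /ev.
  by move/(sd_weyl_eigenP nB dim3 wE); rewrite -chi.
have eig i : exists X,
    [/\ X \in self_dual S, X != 0 & sd_weyl S T X = alpha i *: X].
  apply/(sd_weyl_eigenP nB dim3 wE); rewrite -/I -/J chi.
  by move: i; apply: ord3_ind; rewrite subrr ?(mul0r, mulr0).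
have tr0 : alpha 0 + alpha 1 + alpha 2 = 0.
  (* The roots sum to zero identically, whatever stands for i sqrt 3, beta and I/(3 beta). *)
  have sum0 (w b d : R[i]) : b + d + - 2^-1 * ((1 - w) * b + (1 + w) * d)
      + - 2^-1 * ((1 + w) * b + (1 - w) * d) = 0 by field.
  exact: sum0.
split; first exact: (exists_principal_forms nB dim3 mulB wE inj eig).
move=> P [Ps Pn Po fP _] i; exact: (transverse_components Ps Pn Po dim3 fP tr0).
Qed.
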